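(* Let $(A,B,C)\neq(6,7,10)$ be a nontrivial solution triple of $A!\,B!=C!$. Then: (i) For every real number $v<1+\frac{2+3\log\log 2}{\log 2}=2.299\dots$ there exists $B_0=B_0(v)$ such that every such nontrivial solution with $B\ge B_0$ satisfies $$B-A>C-\frac{\log(C+1)}{\log2}-\frac{3\log\log(C+1)}{\log2}+v.$$ (ii) Every such nontrivial solution satisfies $$B-A>C-\frac{\log(C+1)}{\log2}-\frac{3\log\log(C+1)}{\log2}-3.9411.$$
   Context: A nontrivial solution triple of the equation $A!\,B!=C!$ is a triple of positive integers $(A,B,C)$ with $A\le B\le C-2$ satisfying $A!\,B!=C!$. Here $\log$ denotes the natural logarithm. *)

(* Defs.v *)
From Stdlib Require Import Reals Arith.
Open Scope R_scope.

Definition nontrivial_solution (A B C : nat) : Prop :=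
  (0 < A)%nat /\ (0 < B)%nat /\ (0 < C)%nat /\
  (A <= B)%nat /\ (B + 2 <= C)%nat /\
  (fact A * fact B = fact C)%nat.

(* Stdlib's [ln] is total, with value 0 on nonpositive arguments; a nontrivial
   solution has C >= 3, so 1 < C + 1 and both logarithms are genuine. *)
Definition log_bound (C : nat) : R :=
  INR C - ln (INR C + 1) / ln 2 - 3 * ln (ln (INR C + 1)) / ln 2.

Definition v_sup : R := 1 + (2 + 3 * ln (ln 2)) / ln 2.

(* Main.v *)
Require Import Defs.
From Stdlib Require Import Reals Arith Lia Lra ZArith List Bool.
From Coquelicot Require Import Coquelicot.
Open Scope R_scope.

(** Put K = C - B.  By Legendre, the exponent of 2 in n! lies between
    n - log2 (n + 1) and n - 1, so comparing exponents in A! B! = C! gives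
    A + 1 <= K + log2 (A + 1) + log2 (B + 1).  On the other hand
    (B + 1)^K <= A!, and B >= A forces (A + K)! <= A!^2.  Together these make K
    smaller than about log2 A - 1 / ln 2 and log2 B as large as A - O(log A);
    the constant v_sup is what Stirling's formula then yields, with an error
    O(log^2 A / A).  For A < 256 the same three inequalities, evaluated with
    integer logarithms, settle all pairs (A, K) with A >= 22; for the remaining
    ones a bisection shows that A! is not a product of K consecutive integers
    above A, except for 6! = 8 * 9 * 10. *)

(** * Powers of 2 dividing factorials *)

(** The even factors contribute 2^m m!; the others are the odd numbers below 2m, and their product
    is odd. *)
Lemma fact_double (m : nat) :
  exists q, fact (2 * m) = (2 ^ m * fact m * (2 * q + 1))%nat.
Proof.
  induction m as [|m [q Hq]].
  - exists 0%nat; reflexivity.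
  - exists (2 * m * q + q + m)%nat.
    replace (2 * S m)%nat with (S (S (2 * m))) by lia.
    rewrite !fact_simpl, Hq, Nat.pow_succ_r'. ring.
Qed.

(** For n = 2m and n = 2m + 1 the exponent is m plus that of m!. The bounds are Legendre's n - s(n),
    with the binary digit sum s(n) at most log2 (n + 1) and, for n >= 1, at least 1. *)
Lemma fact_two_adic (n : nat) :
  exists e q, fact n = (2 ^ e * (2 * q + 1))%nat /\
    (n <= e + Nat.log2 (n + 1))%nat /\ ((1 <= n)%nat -> (e + 1 <= n)%nat).
Proof.
  induction n as [n IH] using (well_founded_induction lt_wf).
  destruct (Nat.eq_dec n 0) as [->|Hn].
  { exists 0%nat, 0%nat; simpl; lia. }
  destruct (Nat.Even_or_Odd n) as [[m Hm]|[m Hm]];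
    destruct (IH m ltac:(lia)) as (e & q & Hf & Hlo & Hhi);
    destruct (fact_double m) as [r Hr].
  - exists (m + e)%nat, (2 * q * r + q + r)%nat. subst n. split; [|split].
    + rewrite Hr, Hf, Nat.pow_add_r. ring.
    + assert (Nat.log2 (m + 1) <= Nat.log2 (2 * m + 1))%nat
        by (apply Nat.log2_le_mono; lia). lia.
    + lia.
  - exists (m + e)%nat, ((2 * m + 1) * (2 * q * r + q + r) + m)%nat.
    subst n. split; [|split].
    + replace (2 * m + 1)%nat with (S (2 * m)) at 1 by lia.
      rewrite fact_simpl, Hr, Hf, Nat.pow_add_r. ring.
    + replace (2 * m + 1 + 1)%nat with (2 * (m + 1))%nat by lia.
      rewrite Nat.log2_double by lia. lia.
    + destruct m; [|lia]. intros _.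
      destruct e as [|e]; [lia|]. simpl in Hf. lia.
Qed.

Lemma two_adic_unique (e e' q q' : nat) :
  (2 ^ e * (2 * q + 1) = 2 ^ e' * (2 * q' + 1))%nat -> e = e'.
Proof.
  revert e'; induction e as [|e IH]; intros [|e'] H;
    rewrite ?Nat.pow_succ_r', ?Nat.pow_0_r in H; [lia|nia|nia|].
  f_equal; apply IH; nia.
Qed.

Lemma two_adic_bound (A B K : nat) :
  (1 <= B)%nat -> (fact A * fact B = fact (B + K))%nat ->
  (A + 1 <= K + Nat.log2 (A + 1) + Nat.log2 (B + 1))%nat.
Proof.
  intros HB H.
  destruct (fact_two_adic A) as (eA & qA & HA & HA1 & _).
  destruct (fact_two_adic B) as (eB & qB & HB' & HB1 & _).
  destruct (fact_two_adic (B + K)) as (eC & qC & HC & _ & HC1).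
  assert (eA + eB = eC)%nat.
  { apply (two_adic_unique _ _ (2 * qA * qB + qA + qB)%nat qC).
    rewrite <- HC, <- H, HA, HB', Nat.pow_add_r. ring. }
  lia.
Qed.

(** * Inequalities between factorials *)

Lemma fact_add_ge (B K : nat) :
  ((B + 1) ^ K * fact B <= fact (B + K))%nat.
Proof.
  induction K as [|K IH]; [rewrite Nat.add_0_r; simpl; lia|].
  rewrite (Nat.add_succ_r B K), fact_simpl, Nat.pow_succ_r'. nia.
Qed.

Lemma fact_add_le (m d : nat) : (fact (m + d) <= fact m * (m + d) ^ d)%nat.
Proof.
  induction d as [|d IH]; [rewrite Nat.add_0_r; simpl; lia|].
  rewrite (Nat.add_succ_r m d), fact_simpl, Nat.pow_succ_r'.
  assert ((m + d) ^ d <= S (m + d) ^ d)%nat by (apply Nat.pow_le_mono_l; lia).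
  rewrite (Nat.mul_comm (S (m + d)) (S (m + d) ^ d)), Nat.mul_assoc, Nat.mul_comm.
  apply Nat.mul_le_mono_r. nia.
Qed.

(** The quotients (A + K)! / A! and (B + K)! / B! compare factor by factor. For a solution this
    becomes (A + K)! <= A!^2. *)
Lemma fact_shift_le (A B K : nat) :
  (A <= B)%nat -> (fact (A + K) * fact B <= fact (B + K) * fact A)%nat.
Proof.
  intros HAB; induction K as [|K IH]; [rewrite !Nat.add_0_r; lia|].
  rewrite (Nat.add_succ_r A K), (Nat.add_succ_r B K), !fact_simpl.
  apply Nat.le_trans with (S (B + K) * (fact (A + K) * fact B))%nat; nia.
Qed.

(** Each factor A + j with j <= K <= A is at least 2 j. *)
Lemma pow2_fact_le (A K : nat) :
  (K <= A)%nat -> (2 ^ K * fact A * fact K <= fact (A + K))%nat.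
Proof.
  induction K as [|K IH]; intros HK; [rewrite Nat.add_0_r; simpl; lia|].
  specialize (IH ltac:(lia)).
  rewrite (Nat.add_succ_r A K), !fact_simpl, Nat.pow_succ_r'.
  apply Nat.le_trans with ((2 * S K) * (2 ^ K * fact A * fact K))%nat; nia.
Qed.

(** * Conditions that a solution forces on A, B and K = C - B *)

Definition admissible (A B K : nat) : Prop :=
  (2 <= K < A)%nat /\ (A <= B)%nat /\
  (fact A * fact B = fact (B + K))%nat /\
  (A + 1 <= K + Nat.log2 (A + 1) + Nat.log2 (B + 1))%nat /\
  ((B + 1) ^ K <= fact A)%nat /\
  (fact (A + K) <= fact A * fact A)%nat.

Lemma solution_admissible (A B C : nat) :
  nontrivial_solution A B C -> exists K, C = (B + K)%nat /\ admissible A B K.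
Proof.
  intros (HA & HB & HC & HAB & HBC & H).
  exists (C - B)%nat. split; [lia|].
  set (K := (C - B)%nat). replace C with (B + K)%nat in H by lia.
  assert (HP : ((B + 1) ^ K <= fact A)%nat).
  { pose proof (fact_add_ge B K). pose proof (lt_O_fact B).
    apply (Nat.mul_le_mono_pos_r _ _ (fact B)); lia. }
  repeat split; try lia; try assumption.
  (* If A <= K, then A! <= A^A < (A + 1)^A <= (B + 1)^K, against [HP]. *)
  - destruct (Nat.lt_ge_cases K A) as [|HKA]; [assumption|exfalso].
    pose proof (fact_add_le 0 A) as HF. simpl (fact 0) in HF.
    rewrite Nat.mul_1_l, Nat.add_0_l in HF.
    assert (A ^ A < (A + 1) ^ A)%nat by (apply Nat.pow_lt_mono_l; lia).
    assert ((A + 1) ^ A <= (B + 1) ^ A)%nat by (apply Nat.pow_le_mono_l; lia).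
    assert ((B + 1) ^ A <= (B + 1) ^ K)%nat by (apply Nat.pow_le_mono_r; lia).
    lia.
  - apply two_adic_bound; assumption.
  - pose proof (fact_shift_le A B K HAB) as HS. rewrite <- H in HS.
    pose proof (lt_O_fact B).
    apply (Nat.mul_le_mono_pos_r _ _ (fact B)); nia.
Qed.

(** Combines 2^K K! A! <= (A + K)! <= A!^2 with A! <= K! A^(A - K). It keeps K away from A in the
    range A >= 256. *)
Lemma admissible_pow2_le (A B K : nat) :
  admissible A B K -> (2 ^ K <= A ^ (A - K))%nat.
Proof.
  intros ((HK & HKA) & _ & _ & _ & _ & Hc).
  pose proof (pow2_fact_le A K ltac:(lia)) as H1.
  pose proof (fact_add_le K (A - K)) as H2.
  replace (K + (A - K))%nat with A in H2 by lia.
  pose proof (lt_O_fact A). pose proof (lt_O_fact K).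
  assert (2 ^ K * fact K <= fact A)%nat
    by (apply (Nat.mul_le_mono_pos_r _ _ (fact A)); nia).
  apply (Nat.mul_le_mono_pos_r _ _ (fact K)); lia.
Qed.

(** * The case A < 256 *)

(** Started with f = i!, entry j is log2 of (i + j)! rounded down. The running factorial costs one
    multiplication per entry, and binary integers suit [vm_compute]. *)
Fixpoint log_facts (n : nat) (i f : Z) : list Z :=
  match n with
  | O => nil
  | S n => Z.log2 f :: log_facts n (i + 1) (f * (i + 1))
  end%Z.

Lemma nth_log_facts (n m j : nat) :
  (j < n)%nat ->
  nth j (log_facts n (Z.of_nat m) (Z.of_nat (fact m))) 0%Z =
  Z.log2 (Z.of_nat (fact (m + j))).
Proof.
  revert m j; induction n as [|n IH]; intros m [|j] Hj; try lia.
  - simpl. now rewrite Nat.add_0_r.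
  - cbn [log_facts nth].
    replace (Z.of_nat m + 1)%Z with (Z.of_nat (S m)) by lia.
    replace (Z.of_nat (fact m) * Z.of_nat (S m))%Z
      with (Z.of_nat (fact (S m))) by (rewrite fact_simpl; lia).
    rewrite IH by lia. now rewrite Nat.add_succ_comm.
Qed.

(** The product (b + 1) ... (b + K); thus [rising 0 A] is A! in binary. *)
Fixpoint rising (b : Z) (K : nat) : Z :=
  match K with
  | O => 1
  | S K' => rising b K' * (b + Z.of_nat K)
  end%Z.

Lemma rising_fact (B K : nat) :
  (rising (Z.of_nat B) K * Z.of_nat (fact B) = Z.of_nat (fact (B + K)))%Z.
Proof.
  induction K as [|K IH]; [rewrite Nat.add_0_r; cbn [rising]; lia|].
  rewrite Nat.add_succ_r, fact_simpl. cbn [rising].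
  rewrite Nat2Z.inj_mul, <- IH.
  replace (Z.of_nat (S (B + K))) with (Z.of_nat B + Z.of_nat (S K))%Z by lia.
  ring.
Qed.

Lemma rising_pos (b : Z) (K : nat) : (0 <= b -> 0 < rising b K)%Z.
Proof.
  intros Hb; induction K as [|K IH]; cbn [rising]; [lia|].
  apply Z.mul_pos_pos; lia.
Qed.

Lemma rising_le (b c : Z) (K : nat) :
  (0 <= b <= c -> rising b K <= rising c K)%Z.
Proof.
  intros Hbc; induction K as [|K IH]; cbn [rising]; [lia|].
  pose proof (rising_pos b K ltac:(lia)).
  apply Z.mul_le_mono_nonneg; lia.
Qed.

Lemma rising_lt (b c : Z) (K : nat) :
  (1 <= K)%nat -> (0 <= b < c -> rising b K < rising c K)%Z.
Proof.
  intros HK Hbc. destruct K as [|K]; [lia|]. cbn [rising].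
  pose proof (rising_pos b K ltac:(lia)).
  pose proof (rising_le b c K ltac:(lia)). nia.
Qed.

(* The largest [b' < b + 2 ^ n] with [rising b' K <= F]; nothing is proved about
   it, as [no_solution_at] tests the bracketing of [F] itself. *)
Fixpoint bisect (n : nat) (b : Z) (K : nat) (F : Z) : Z :=
  match n with
  | O => b
  | S n' =>
      let b' := (b + 2 ^ Z.of_nat n')%Z in
      bisect n' (if (rising b' K <=? F)%Z then b' else b) K F
  end.

(** The product is strictly increasing in its base, so the bracketing leaves [b] as the only
    candidate for B; the last clause rejects it, apart from 6! = 8 · 9 · 10. *)
Definition no_solution_at (b : Z) (A K : nat) : bool :=
  ((0 <=? b) && (rising b K <=? rising 0 A) && (rising 0 A <? rising (b + 1) K) &&
   (negb (rising b K =? rising 0 A) || (b <? Z.of_nat A) ||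
    ((A =? 6)%nat && (b =? 7) && (K =? 3)%nat)))%Z%bool.

(** Here [t] is log2 of A! rounded down and [m] is the lower bound for log2 (B + 1) given by the
    2-adic inequality. The first test refutes (B + 1)^K <= A!, the second (A + K)! <= A!^2. The
    third excludes nothing but certifies the wanted estimate; the pairs left over are bisected. *)
Definition pair_ok (logs : list Z) (A K : nat) : bool :=
  let t := nth A logs 0%Z in
  let lam := Z.log2 (Z.of_nat A + 1) in
  let m := (Z.of_nat A + 1 - Z.of_nat K - lam)%Z in
  if (t <? Z.of_nat K * m)%Z then true
  else if (2 * t + 1 <? nth (A + K) logs 0)%Z then true
  else if (if 0 <? m then 2 ^ (2 * Z.of_nat K + lam) <=? 10 * m ^ 3 else false)%Z
  then true
  else no_solution_at (bisect 40 0 K (rising 0 A)) A K.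

Definition pairs_ok (N : nat) : bool :=
  let logs := log_facts (2 * N) 0 1 in
  forallb (fun A => forallb (pair_ok logs A) (seq 2 (A - 2))) (seq 2 (N - 2)).

Lemma no_solution_at_spec (b : Z) (A B K : nat) :
  (1 <= K)%nat -> (A <= B)%nat -> (fact A * fact B = fact (B + K))%nat ->
  no_solution_at b A K = true -> (A, B, K) = (6, 7, 3)%nat.
Proof.
  intros HK HAB H Hno.
  assert (HF : rising 0 A = Z.of_nat (fact A)).
  { pose proof (rising_fact 0 A) as E. simpl (fact 0) in E. simpl (0 + A)%nat in E.
    change (Z.of_nat 0) with 0%Z in E. lia. }
  assert (HR : rising (Z.of_nat B) K = rising 0 A).
  { pose proof (rising_fact B K) as E. rewrite <- H, Nat2Z.inj_mul, <- HF in E.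
    pose proof (lt_O_fact B). nia. }
  unfold no_solution_at in Hno.
  rewrite !andb_true_iff, !orb_true_iff, negb_true_iff, !andb_true_iff in Hno.
  destruct Hno as [[[Hb Hlo] Hhi] Hd].
  apply Z.leb_le in Hb, Hlo. apply Z.ltb_lt in Hhi.
  assert (b = Z.of_nat B).
  { destruct (Z.lt_trichotomy b (Z.of_nat B)) as [Hlt|[Heq|Hlt]]; [exfalso|assumption|exfalso].
    - pose proof (rising_le (b + 1) (Z.of_nat B) K ltac:(lia)). lia.
    - pose proof (rising_lt (Z.of_nat B) b K HK ltac:(lia)). lia. }
  destruct Hd as [[Hd|Hd]|[[Hd1 Hd2] Hd3]].
  - apply Z.eqb_neq in Hd. congruence.
  - apply Z.ltb_lt in Hd. lia.
  - apply Nat.eqb_eq in Hd1, Hd3. apply Z.eqb_eq in Hd2.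
    repeat f_equal; lia.
Qed.

Lemma nat_log2_Z (n : nat) : Z.of_nat (Nat.log2 n) = Z.log2 (Z.of_nat n).
Proof.
  destruct n as [|n]; [reflexivity|].
  symmetry; apply Z.log2_unique; [lia|].
  destruct (Nat.log2_spec (S n) ltac:(lia)) as [H1 H2].
  rewrite <- Nat2Z.inj_succ, <- !(Nat2Z.inj_pow 2). lia.
Qed.

Lemma pair_ok_spec (logs : list Z) (A B K : nat) :
  nth A logs 0%Z = Z.log2 (Z.of_nat (fact A)) ->
  nth (A + K) logs 0%Z = Z.log2 (Z.of_nat (fact (A + K))) ->
  pair_ok logs A K = true ->
  admissible A B K -> (A, B, K) <> (6, 7, 3)%nat ->
  exists m, (0 < m)%nat /\ (m <= Nat.log2 (B + 1))%nat /\
    (2 ^ (2 * K + Nat.log2 (A + 1)) <= 10 * m ^ 3)%nat.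
Proof.
  intros HN1 HN2 Hok (HK & HAB & H & Ha & Hb & Hc) Hex.
  unfold pair_ok in Hok. cbv zeta in Hok. rewrite HN1, HN2 in Hok. clear HN1 HN2.
  replace (Z.of_nat A + 1)%Z with (Z.of_nat (A + 1)) in Hok by lia.
  rewrite <- !nat_log2_Z in Hok.
  set (lam := Nat.log2 (A + 1)) in *. set (mu := Nat.log2 (B + 1)) in *.
  pose proof (lt_O_fact A) as HFA.
  destruct (Z.ltb_spec (Z.of_nat (Nat.log2 (fact A)))
    (Z.of_nat K * (Z.of_nat (A + 1) - Z.of_nat K - Z.of_nat lam))) as [H1|_].
  { exfalso.
    assert (2 ^ (mu * K) <= fact A)%nat.
    { apply Nat.le_trans with ((B + 1) ^ K)%nat; [|assumption].
      rewrite Nat.pow_mul_r. apply Nat.pow_le_mono_l.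
      apply Nat.log2_spec; lia. }
    assert (mu * K <= Nat.log2 (fact A))%nat
      by (rewrite <- (Nat.log2_pow2 (mu * K)) by lia; now apply Nat.log2_le_mono).
    nia. }
  destruct (Z.ltb_spec (2 * Z.of_nat (Nat.log2 (fact A)) + 1)
    (Z.of_nat (Nat.log2 (fact (A + K))))) as [H1|_].
  { exfalso.
    pose proof (Nat.log2_le_mono _ _ Hc).
    pose proof (Nat.log2_mul_above (fact A) (fact A) ltac:(lia) ltac:(lia)). lia. }
  destruct (Z.ltb_spec 0 (Z.of_nat (A + 1) - Z.of_nat K - Z.of_nat lam)) as [Hm|_].
  2: { exfalso; apply Hex; eapply no_solution_at_spec; eauto; lia. }
  match type of Hok with (if ?c then _ else _) = _ => destruct c eqn:E end.
  2: { exfalso; apply Hex; eapply no_solution_at_spec; eauto; lia. }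
  apply Z.leb_le in E.
  exists (A + 1 - K - lam)%nat. split; [lia|split; [lia|]].
  apply Nat2Z.inj_le. rewrite Nat2Z.inj_mul, !Nat2Z.inj_pow.
  replace (Z.of_nat (2 * K + lam)) with (2 * Z.of_nat K + Z.of_nat lam)%Z by lia.
  replace (Z.of_nat (A + 1 - K - lam)) with
    (Z.of_nat (A + 1) - Z.of_nat K - Z.of_nat lam)%Z by lia.
  exact E.
Qed.

Lemma pairs_ok_pair_ok (N A K : nat) :
  pairs_ok N = true -> (A < N)%nat -> (2 <= K < A)%nat ->
  pair_ok (log_facts (2 * N) 0 1) A K = true.
Proof.
  unfold pairs_ok; intros Hok HA HK.
  rewrite forallb_forall in Hok.
  specialize (Hok A ltac:(apply in_seq; lia)).
  rewrite forallb_forall in Hok.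
  apply Hok, in_seq; lia.
Qed.

Lemma pairs_ok_spec (N A B K : nat) :
  pairs_ok N = true -> (A < N)%nat ->
  admissible A B K -> (A, B, K) <> (6, 7, 3)%nat ->
  exists m, (0 < m)%nat /\ (m <= Nat.log2 (B + 1))%nat /\
    (2 ^ (2 * K + Nat.log2 (A + 1)) <= 10 * m ^ 3)%nat.
Proof.
  intros Hok HA Hadm.
  pose proof Hadm as [HK _].
  apply (pair_ok_spec (log_facts (2 * N) 0 1)); trivial.
  - apply (nth_log_facts (2 * N) 0 A). lia.
  (* K < A < N keeps A + K inside the table, so the default 0 is not read. *)
  - apply (nth_log_facts (2 * N) 0 (A + K)). lia.
  - now apply pairs_ok_pair_ok.
Qed.

Lemma pairs_ok_256 : pairs_ok 256 = true.
Proof. vm_compute. reflexivity. Qed.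

(** * Bounds on logarithms *)

(* Truncating after an odd power leaves a remainder of even order, so this is a
   lower bound of [exp] on the whole line. *)
Definition exp_taylor7 (x : R) : R :=
  1 + x * (1 + x / 2 * (1 + x / 3 * (1 + x / 4 * (1 + x / 5 *
    (1 + x / 6 * (1 + x / 7)))))).

(** The function exp (-t) [exp_taylor7] t has derivative -exp (-t) t^7 / 7!, of sign opposite to t,
    so its maximum is its value 1 at 0. *)
Lemma exp_taylor7_le (x : R) : exp_taylor7 x <= exp x.
Proof.
  set (f := fun t : R => exp (- t) * exp_taylor7 t).
  assert (Hd : forall t, is_derive f t (- (exp (- t) * (t ^ 7 / 5040)))).
  { intros t; unfold f, exp_taylor7; auto_derive; [trivial|field]. }
  assert (Hf0 : f 0 = 1).
  { unfold f, exp_taylor7. rewrite Ropp_0, exp_0. field. }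
  assert (Hf : f x <= f 0).
  { destruct (MVT_gen f 0 x (fun t => - (exp (- t) * (t ^ 7 / 5040))))
      as (c & Hc & E).
    - intros t _; apply Hd.
    - intros t _. apply continuity_pt_filterlim.
      apply (ex_derive_continuous f). eexists; apply Hd.
    - pose proof (exp_pos (- c)) as Hexp.
      assert (Hc7 : 0 <= c ^ 7 * (x - 0)).
      { replace (c ^ 7 * (x - 0)) with ((c ^ 3) ^ 2 * (c * x)) by ring.
        apply Rmult_le_pos; [apply pow2_ge_0|].
        unfold Rmin, Rmax in Hc. destruct (Rle_dec 0 x); nra. }
      assert (f x - f 0 = - (exp (- c) / 5040 * (c ^ 7 * (x - 0))))
        by (rewrite E; field).
      assert (0 <= exp (- c) / 5040 * (c ^ 7 * (x - 0)))
        by (apply Rmult_le_pos; lra).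
      lra. }
  rewrite Hf0 in Hf. unfold f in Hf. rewrite exp_Ropp in Hf.
  pose proof (exp_pos x) as Hx.
  apply (Rmult_le_compat_l (exp x)) in Hf; [|lra].
  rewrite <- Rmult_assoc, Rinv_r, Rmult_1_l, Rmult_1_r in Hf; lra.
Qed.

(** An upper bound for exp y comes from the lower bound for exp (-y), so one polynomial serves both
    directions. *)
Lemma ln_ge_taylor7 (x y : R) : 0 < x -> exp_taylor7 (- y) * x >= 1 -> ln x >= y.
Proof.
  intros Hx H. pose proof (exp_taylor7_le (- y)) as HT.
  rewrite exp_Ropp in HT. pose proof (exp_pos y) as Hy.
  apply Rle_ge. rewrite <- (ln_exp y). apply ln_le; [assumption|].
  apply (Rmult_le_reg_l (/ exp y)); [now apply Rinv_0_lt_compat|].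
  rewrite Rinv_l by lra. nra.
Qed.

Lemma ln_le_taylor7 (x y : R) : 0 < x -> x <= exp_taylor7 y -> ln x <= y.
Proof.
  intros Hx H. rewrite <- (ln_exp y). apply ln_le; [assumption|].
  eapply Rle_trans; [exact H|apply exp_taylor7_le].
Qed.

Lemma ln2_bounds : 693144 / 1000000 <= ln 2 <= 693149 / 1000000.
Proof.
  split.
  - apply Rge_le, ln_ge_taylor7; unfold exp_taylor7; lra.
  - apply ln_le_taylor7; unfold exp_taylor7; lra.
Qed.

Lemma lnln2_bounds : - (36652 / 100000) <= ln (ln 2) <= - (36650 / 100000).
Proof.
  pose proof ln2_bounds as H. split.
  - apply Rge_le, ln_ge_taylor7; unfold exp_taylor7; lra.
  - apply ln_le_taylor7; unfold exp_taylor7; lra.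
Qed.

Lemma v_sup_bounds : 2299 / 1000 <= v_sup < 2300 / 1000.
Proof.
  pose proof ln2_bounds as H. pose proof lnln2_bounds as H'.
  unfold v_sup.
  assert (1299 / 1000 <= (2 + 3 * ln (ln 2)) / ln 2) by (apply (Rle_div_r _ _ (ln 2)); lra).
  assert ((2 + 3 * ln (ln 2)) / ln 2 < 1300 / 1000) by (apply (Rlt_div_l _ _ (ln 2)); lra).
  lra.
Qed.

Lemma ln_le_pred (x : R) : 0 < x -> ln x <= x - 1.
Proof.
  intros Hx. pose proof (exp_ineq1_le (ln x)) as H. rewrite exp_ln in H; lra.
Qed.

Lemma ln_sub_ge (x y : R) : 0 < x -> 0 < y -> ln y - ln x >= 1 - x / y.
Proof.
  intros Hx Hy. pose proof (ln_le_pred (x / y) (Rdiv_lt_0_compat _ _ Hx Hy)) as H.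
  rewrite ln_div in H; lra.
Qed.

(** A crude Stirling bound, from (n + 1) (ln (n + 1) - ln n) >= 1. The excess of about (ln n) / 2 is
    harmless after division by A. *)
Lemma ln_fact_le (n : nat) :
  (1 <= n)%nat -> ln (INR (fact n)) <= (INR n + 1) * ln (INR n) - INR n + 1.
Proof.
  induction 1 as [|n Hn IH]; [simpl; rewrite ln_1; lra|].
  pose proof (lt_0_INR n ltac:(lia)) as Hp.
  rewrite fact_simpl, mult_INR, ln_mult;
    [|apply lt_0_INR; lia|apply INR_fact_lt_0].
  rewrite S_INR in *.
  pose proof (ln_sub_ge (INR n) (INR n + 1) ltac:(lra) ltac:(lra)) as H.
  assert ((INR n + 1) * (ln (INR n + 1) - ln (INR n)) >= 1).
  { replace (1 - INR n / (INR n + 1)) with (/ (INR n + 1)) in H by (field; lra).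
    pose proof (Rinv_r (INR n + 1) ltac:(lra)). nra. }
  lra.
Qed.

(** * Base-2 logarithms and the reduction to a bound on K *)

Definition lg (x : R) : R := ln x / ln 2.

Lemma lg_mono (x y : R) : 0 < x -> x <= y -> lg x <= lg y.
Proof.
  intros Hx Hxy. pose proof ln2_bounds. unfold lg.
  apply Rmult_le_compat_r; [|now apply ln_le].
  apply Rlt_le, Rinv_0_lt_compat; lra.
Qed.

Lemma ln_pow_nat (b n : nat) : (0 < b)%nat -> ln (INR (b ^ n)) = INR n * ln (INR b).
Proof.
  intros Hb. rewrite pow_INR, ln_pow; [reflexivity|now apply lt_0_INR].
Qed.

Lemma log2_le_lg (n : nat) : (0 < n)%nat -> INR (Nat.log2 n) <= lg (INR n).
Proof.
  intros Hn. pose proof ln2_bounds. unfold lg. apply (Rle_div_r _ _ (ln 2)); [lra|].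
  change 2 with (INR 2) at 1. rewrite <- ln_pow_nat by lia.
  apply ln_le.
  - apply lt_0_INR. pose proof (Nat.pow_nonzero 2 (Nat.log2 n)). lia.
  - apply le_INR, Nat.log2_spec, Hn.
Qed.

(* By [two_adic_bound], [A + K] is at most [2 K + log2 (A + 1) + log2 (B + 1) - 1],
   so the bound on [K] and [A] is all that remains to be shown. *)
Lemma gap_reduction (A B K : nat) (m v : R) :
  admissible A B K -> 0 < m -> m <= INR (Nat.log2 (B + 1)) ->
  2 * INR K + INR (Nat.log2 (A + 1)) - 1 < 3 * lg (m * ln 2) - v ->
  INR B - INR A > log_bound (B + K) + v.
Proof.
  intros (_ & _ & _ & Ha & _) Hm HmB H.
  pose proof ln2_bounds as H2.
  apply le_INR in Ha. rewrite !plus_INR in Ha. simpl (INR 1) in Ha.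
  unfold log_bound. fold (lg (INR (B + K) + 1)).
  set (l := INR (Nat.log2 (B + 1))) in *.
  set (M := lg (INR (B + K) + 1)).
  assert (HlM : l <= M).
  { unfold l, M. eapply Rle_trans; [apply log2_le_lg; lia|].
    rewrite <- S_INR. apply lg_mono; [apply lt_0_INR; lia|apply le_INR; lia]. }
  replace (ln (INR (B + K) + 1)) with (M * ln 2) by (unfold M, lg; field; lra).
  assert (lg (m * ln 2) <= lg (M * ln 2)).
  { apply lg_mono; [apply Rmult_lt_0_compat; lra|].
    apply Rmult_le_compat_r; lra. }
  replace (3 * ln (M * ln 2) / ln 2) with (3 * lg (M * ln 2))
    by (unfold lg; field; lra).
  rewrite plus_INR. lra.
Qed.

Lemma bound_small (A B K : nat) :
  (A < 256)%nat -> admissible A B K -> (A, B, K) <> (6, 7, 3)%nat ->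
  INR B - INR A > log_bound (B + K) - 39411 / 10000.
Proof.
  intros HA Hadm Hex.
  destruct (pairs_ok_spec 256 A B K pairs_ok_256 HA Hadm Hex) as (m & Hm0 & Hm & H).
  pose proof ln2_bounds as H2. pose proof lnln2_bounds as H3.
  pose proof (lt_0_INR m Hm0) as Hmp.
  apply (gap_reduction A B K (INR m)); [assumption|assumption|now apply le_INR|].
  unfold lg. rewrite ln_mult by lra.
  apply le_INR, ln_le in H.
  2: { apply lt_0_INR. pose proof (Nat.pow_nonzero 2 (2 * K + Nat.log2 (A + 1))). lia. }
  rewrite ln_pow_nat, mult_INR, ln_mult, ln_pow_nat in H;
    [|lia|apply lt_0_INR; lia|apply lt_0_INR; pose proof (Nat.pow_nonzero m 3); lia|lia].
  rewrite plus_INR, mult_INR in H.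
  (* From 10^3 <= 2^10, lg 10 <= 10/3; and 10/3 - 1 < 3.9411 + 3 lg (ln 2), about 2.354. This margin
     explains the factor 10 in [pair_ok]. *)
  assert (H10 : INR 3 * ln (INR 10) <= INR 10 * ln (INR 2)).
  { rewrite <- !ln_pow_nat by lia. apply ln_le; [apply lt_0_INR; simpl; lia|].
    apply le_INR, Nat.leb_le. reflexivity. }
  rewrite !(INR_IZR_INZ 2), !(INR_IZR_INZ 3), !(INR_IZR_INZ 10) in *.
  simpl IZR in *.
  replace (3 * ((ln (INR m) + ln (ln 2)) / ln 2)) with
    ((3 * ln (INR m) + 3 * ln (ln 2)) / ln 2) by (field; lra).
  apply Rplus_lt_reg_r with (- (39411 / 10000)). ring_simplify.
  apply (Rlt_div_r _ _ (ln 2)); [lra|]. nra.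
Qed.

(** * The case A >= 256 *)

(* Combining [a - k <= g + l - 1] with [k * l <= T] leaves only [k] close to [a],
   excluded by the last hypothesis, or [k] of order [g]; the latter makes [l]
   close to [a] and then [k] close to [T / a]. *)
Lemma large_case_split (a k l g h c T : R) :
  144 / 100 <= c <= 145 / 100 -> 8 <= g -> 3 * (g * g) <= a ->
  0 <= k -> 0 <= h <= g ->
  a + 1 <= k + g + l -> k * l <= T -> T <= (a + 1) * h - c * (a - 1) ->
  k <= (a - k) * g ->
  k * a <= a * (h - c) + 6 * (g * g) /\ a - 3 * g <= l.
Proof.
  intros Hc Hg Ha Hk Hh H1 H2 H3 H4.
  assert (Ha24 : 24 * g <= a) by nra.
  assert (HT1 : T <= a * (g - 1)) by nra.
  assert (HT2 : T <= a * (h - c) + 2 * g) by nra.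
  destruct (Rle_or_lt k (a / 2)) as [Hka|Hka].
  (* Small k: k l <= T first gives k <= 2 g, hence l >= a + 1 - 3 g, and then k a <= T + 2 g (3 g -
     1). *)
  - assert (Hl : a / 2 + 1 - g <= l) by lra.
    assert (Hk2 : k <= 2 * g).
    { apply Rnot_lt_le; intros Hlt.
      assert (2 * g * (a / 2 + 1 - g) < k * l).
      { apply Rlt_le_trans with (k * (a / 2 + 1 - g)).
        - apply Rmult_lt_compat_r; lra.
        - apply Rmult_le_compat_l; lra. }
      nra. }
    assert (Hl3 : a + 1 - 3 * g <= l) by lra.
    split; [|lra].
    assert (k * (a + 1 - 3 * g) <= k * l) by (apply Rmult_le_compat_l; lra).
    assert (k * (3 * g - 1) <= 2 * g * (3 * g - 1)) by (apply Rmult_le_compat_r; lra).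
    lra.
  (* Large k: l <= 2 (g - 1) gives a - k <= 3 g - 3, hence k <= 3 g^2 - 3 g; the sum contradicts 3
     g^2 <= a. *)
  - exfalso.
    assert (Hl : l <= 2 * (g - 1)).
    { apply Rnot_lt_le; intros Hlt.
      assert (a / 2 * (2 * (g - 1)) < k * l)
        by (apply Rmult_le_0_lt_compat; lra).
      lra. }
    assert (a - k <= 3 * g - 3) by lra.
    assert ((a - k) * g <= (3 * g - 3) * g) by (apply Rmult_le_compat_r; lra).
    nra.
Qed.

(** With n = log2 (A + 1) rounded down, 3 (n + 1)^2 + 1 <= 2^n <= A + 1 for n >= 8. The first
    inequality fails at n = 7, whence the threshold 256. *)
Lemma lg_large (A : nat) :
  (256 <= A)%nat ->
  8 <= lg (INR A + 1) /\ 3 * (lg (INR A + 1) * lg (INR A + 1)) <= INR A.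
Proof.
  intros HA. pose proof ln2_bounds as H2.
  assert (Hp : forall n, (8 <= n)%nat -> (3 * ((n + 1) * (n + 1)) + 1 <= 2 ^ n)%nat).
  { induction 1 as [|n Hn IH]; [apply Nat.leb_le; reflexivity|].
    rewrite Nat.pow_succ_r'. nia. }
  rewrite <- S_INR. set (n := Nat.log2 (S A)).
  assert (Hn : (8 <= n)%nat).
  { change 8%nat with (Nat.log2 256). apply Nat.log2_le_mono. lia. }
  destruct (Nat.log2_spec (S A) ltac:(lia)) as [Hlo Hhi]. fold n in Hlo, Hhi.
  assert (Hg1 : INR n <= lg (INR (S A))) by (apply log2_le_lg; lia).
  assert (Hg2 : lg (INR (S A)) <= INR (n + 1)).
  { unfold lg. apply (Rle_div_l _ _ (ln 2)); [lra|].
    change 2 with (INR 2). rewrite <- ln_pow_nat by lia.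
    apply ln_le; [apply lt_0_INR; lia|apply le_INR].
    rewrite Nat.add_1_r. lia. }
  assert (Hn8 : 8 <= INR n).
  { apply le_INR in Hn. rewrite (INR_IZR_INZ 8) in Hn. exact Hn. }
  split; [lra|].
  assert (HpA : (3 * ((n + 1) * (n + 1)) <= A)%nat) by (specialize (Hp n Hn); lia).
  apply le_INR in HpA. rewrite !mult_INR in HpA. rewrite (INR_IZR_INZ 3) in HpA.
  simpl IZR in HpA. nra.
Qed.

(** Losses of the large case divided by A: 12 g^2 is twice the 6 g^2 in the bound on K A, and 28 g
    covers replacing log2 (B + 1) by A (three times 8.7 g) and lg A by g (at most 1 / ln 2). *)
Definition err (A : nat) : R :=
  let g := lg (INR A + 1) in (12 * (g * g) + 28 * g) / INR A.

(** With c = 1 / ln 2, [v_sup] is 1 + 2 c + 3 lg (ln 2): the 1 comes from the 2-adic bound, 2 c from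
    Stirling's K <= lg A - c (up to the error) used twice, and 3 lg (ln 2) from the iterated
    logarithm. *)
Lemma bound_large (A B K : nat) :
  (256 <= A)%nat -> admissible A B K ->
  INR B - INR A > log_bound (B + K) + (v_sup - err A).
Proof.
  intros HA Hadm.
  pose proof (admissible_pow2_le A B K Hadm) as Hc.
  pose proof Hadm as ((HK2 & HKA) & HAB & _ & Ha & Hb & _).
  pose proof (lg_large A HA) as [Hg8 Hg2].
  pose proof ln2_bounds as H2.
  assert (HlamR := log2_le_lg (A + 1) ltac:(lia)).
  assert (Hl : INR K * INR (Nat.log2 (B + 1)) <= lg (INR (fact A))).
  { apply Rle_trans with (lg (INR ((B + 1) ^ K))).
    - unfold lg. rewrite ln_pow_nat by lia. unfold Rdiv. rewrite Rmult_assoc.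
      apply Rmult_le_compat_l; [apply pos_INR|apply log2_le_lg; lia].
    - apply lg_mono; [|now apply le_INR].
      apply lt_0_INR. pose proof (Nat.pow_nonzero (B + 1) K). lia. }
  assert (HpA := lt_0_INR A ltac:(lia)).
  set (c := / ln 2).
  assert (Hc1 : 144 / 100 <= c <= 145 / 100).
  { assert (c * ln 2 = 1) by (unfold c; field; lra). nra. }
  assert (Hfact : lg (INR (fact A)) <= (INR A + 1) * lg (INR A) - c * (INR A - 1)).
  { pose proof (ln_fact_le A ltac:(lia)) as HF. unfold lg, Rdiv. fold c. nra. }
  assert (Hh0 : 0 <= lg (INR A)).
  { unfold lg. apply (Rle_div_r _ _ (ln 2)); [lra|].
    rewrite Rmult_0_l, <- ln_1. apply ln_le; [lra|].
    change 1 with (INR 1). apply le_INR. lia. }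
  assert (Hhg : lg (INR A) <= lg (INR A + 1)) by (apply lg_mono; lra).
  assert (Hgh : (lg (INR A + 1) - lg (INR A)) * INR A <= c).
  { pose proof (ln_sub_ge (INR A + 1) (INR A) ltac:(lra) HpA) as HL.
    assert ((ln (INR A + 1) - ln (INR A)) * INR A <= 1).
    { replace (1 - (INR A + 1) / INR A) with (- / INR A) in HL by (field; lra).
      pose proof (Rinv_l (INR A) ltac:(lra)). nra. }
    unfold lg, Rdiv. fold c. nra. }
  assert (Hkg : INR K <= (INR A - INR K) * lg (INR A + 1)).
  { apply le_INR, ln_le in Hc.
    2: { apply lt_0_INR. pose proof (Nat.pow_nonzero 2 K). lia. }
    rewrite !ln_pow_nat in Hc by lia.
    rewrite minus_INR in Hc by lia. change (INR 2) with 2 in Hc.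
    assert (INR K <= (INR A - INR K) * lg (INR A)).
    { replace ((INR A - INR K) * lg (INR A)) with
        ((INR A - INR K) * ln (INR A) / ln 2) by (unfold lg; field; lra).
      apply (Rle_div_r _ _ (ln 2)); lra. }
    apply lt_INR in HKA.
    assert ((INR A - INR K) * lg (INR A) <= (INR A - INR K) * lg (INR A + 1))
      by (apply Rmult_le_compat_l; lra).
    lra. }
  apply le_INR in Ha. rewrite !plus_INR in Ha. simpl (INR 1) in Ha.
  rewrite !plus_INR in HlamR. simpl (INR 1) in HlamR.
  unfold err; cbv zeta.
  set (g := lg (INR A + 1)) in *. set (h := lg (INR A)) in *.
  set (a := INR A) in *. set (k := INR K) in *.
  set (l := INR (Nat.log2 (B + 1))) in *.
  destruct (large_case_split a k l g h c (lg (INR (fact A))))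
    as [Hk Hla]; try lra; [apply pos_INR|].
  assert (Ha24 : 24 * g <= a) by nra.
  apply (gap_reduction A B K l); [assumption|lra|unfold l; lra|].
  fold k.
  (* Uses ln a - ln l <= a / l - 1, and a^2 <= (a + 6 g) (a - 3 g) <= (a + 6 g) l. *)
  assert (Hln : a * (ln a - ln l) <= 6 * g).
  { pose proof (ln_sub_ge a l ltac:(lra) ltac:(lra)) as HL.
    assert (a / l * a <= a + 6 * g).
    { unfold Rdiv. replace (a * / l * a) with (a * a / l) by (field; lra).
      apply (Rle_div_l _ _ l); [lra|].
      assert ((a + 6 * g) * (a - 3 * g) <= (a + 6 * g) * l)
        by (apply Rmult_le_compat_l; lra).
      assert (0 <= g * (3 * a - 18 * g)) by (apply Rmult_le_pos; lra).
      lra. }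
    nra. }
  assert (HE : (12 * (g * g) + 28 * g) / a * a = 12 * (g * g) + 28 * g)
    by (field; lra).
  set (E := (12 * (g * g) + 28 * g) / a) in *.
  unfold v_sup, lg. rewrite ln_mult by lra.
  unfold Rdiv. fold c.
  assert (Hha : h * a = ln a * c * a) by reflexivity.
  apply Rmult_lt_reg_r with a; [lra|].
  assert (Hlc : a * (ln a - ln l) * c <= 6 * g * (145 / 100)) by nra.
  assert (INR (Nat.log2 (A + 1)) * a <= g * a) by (apply Rmult_le_compat_r; lra).
  lra.
Qed.

(** The value 6 suffices for the uniform bound, since [v_sup] - 6 >= -3.701 > -3.9411. *)
Lemma err_le (A : nat) : (256 <= A)%nat -> err A <= 6.
Proof.
  intros HA. pose proof (lg_large A HA) as [H1 H2].
  unfold err; cbv zeta. set (g := lg (INR A + 1)) in *.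
  assert (0 < INR A) by nra.
  apply (Rle_div_l _ _ (INR A)); nra.
Qed.

(** Applying ln s <= s - 1 to s = (A + 1)^(1/4) gives lg (A + 1) <= 6 s, so the numerator of [err]
    is O(sqrt A). *)
Lemma err_small (eps : R) :
  0 < eps -> exists A0, forall A, (A0 <= A)%nat -> err A < eps.
Proof.
  intros Heps.
  (* The numerator is at most 16 g^2 <= 576 sqrt x with x = A + 1 <= 2 A; 4000 leaves room above 2 ·
     576. *)
  exists (Nat.max 256 (S (Z.to_nat (up ((4000 / eps) ^ 2))))).
  intros A HA.
  pose proof (lg_large A ltac:(lia)) as [H1 H2].
  set (x := INR A + 1). set (s := sqrt (sqrt x)).
  assert (HA1 : 1 <= INR A) by nra.
  assert (Hx : 0 < x) by (unfold x; lra).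
  assert (Hs : 0 < s) by (unfold s; apply sqrt_lt_R0, sqrt_lt_R0; assumption).
  assert (Hs2 : s * s = sqrt x) by (apply sqrt_sqrt, sqrt_pos).
  assert (Hs4 : sqrt x * sqrt x = x) by (apply sqrt_sqrt; lra).
  pose proof ln2_bounds as HL2.
  assert (Hg : lg x <= 6 * s).
  { unfold lg. apply (Rle_div_l _ _ (ln 2)); [lra|].
    rewrite <- Hs4, <- Hs2, !ln_mult by (try apply Rmult_lt_0_compat; assumption).
    pose proof (ln_le_pred s Hs). nra. }
  unfold err; cbv zeta. fold x. fold x in H1, H2.
  set (g := lg x) in *.
  apply (Rlt_div_l _ _ (INR A)); [lra|].
  assert (Hbig : 4000 / eps < sqrt x).
  { assert (Hup : (4000 / eps) ^ 2 < INR A).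
    { destruct (archimed ((4000 / eps) ^ 2)) as [Hu _].
      apply Rlt_le_trans with (1 := Hu).
      rewrite INR_IZR_INZ. apply IZR_le. lia. }
    apply Rlt_le_trans with (sqrt (INR A)).
    - rewrite <- (sqrt_pow2 (4000 / eps)) by (apply Rlt_le, Rdiv_lt_0_compat; lra).
      apply sqrt_lt_1_alt. split; [apply pow2_ge_0|assumption].
    - apply sqrt_le_1_alt. unfold x. lra. }
  assert (Hq : 4000 < eps * sqrt x).
  { apply (Rlt_div_l _ _ eps) in Hbig; lra. }
  assert (Hgg : g * g <= 36 * sqrt x) by (rewrite <- Hs2; nra).
  assert (12 * (g * g) + 28 * g <= 16 * (g * g)) by nra.
  assert (Hsx : 0 < sqrt x) by (rewrite <- Hs2; nra).
  assert (4000 * sqrt x < eps * x).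
  { replace (eps * x) with (eps * sqrt x * sqrt x) by (rewrite Rmult_assoc, Hs4; ring).
    now apply Rmult_lt_compat_r. }
  assert (eps * x <= eps * (2 * INR A)) by (apply Rmult_le_compat_l; unfold x; lra).
  lra.
Qed.

(** * Assembling the two ranges of A; large B forces large A *)

Theorem theorem3 :
  2299 / 1000 <= v_sup < 2300 / 1000 /\
  (forall v : R, v < v_sup ->
     exists B0 : nat, forall A B C : nat,
       nontrivial_solution A B C -> (A, B, C) <> (6, 7, 10)%nat ->
       (B0 <= B)%nat ->
       INR B - INR A > log_bound C + v) /\
  (forall A B C : nat,
     nontrivial_solution A B C -> (A, B, C) <> (6, 7, 10)%nat ->
     INR B - INR A > log_bound C - 39411 / 10000).
Proof.
  split; [exact v_sup_bounds|split].
  - intros v Hv. destruct (err_small (v_sup - v) ltac:(lra)) as [A0 HA0].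
    (* Since B + 1 <= (B + 1)^K <= A!, this choice of B0 forces A > max (A0, 256). *)
    exists (fact (Nat.max A0 256)). intros A B C Hsol _ HB.
    destruct (solution_admissible A B C Hsol) as (K & -> & Hadm).
    assert (HA : (Nat.max A0 256 < A)%nat).
    { destruct (Nat.lt_ge_cases (Nat.max A0 256) A) as [|HA]; [assumption|exfalso].
      apply fact_le in HA. destruct Hadm as ((HK & _) & _ & _ & _ & Hb & _).
      assert ((B + 1) ^ 1 <= (B + 1) ^ K)%nat by (apply Nat.pow_le_mono_r; lia).
      rewrite Nat.pow_1_r in *. lia. }
    pose proof (bound_large A B K ltac:(lia) Hadm).
    specialize (HA0 A ltac:(lia)). lra.
  - intros A B C Hsol Hex.
    destruct (solution_admissible A B C Hsol) as (K & -> & Hadm).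
    destruct (Nat.lt_ge_cases A 256) as [HA|HA].
    + apply (bound_small A B K HA Hadm).
      intros E; inversion E; subst. now apply Hex.
    + pose proof (bound_large A B K HA Hadm).
      pose proof (err_le A HA). pose proof v_sup_bounds. lra.
Qed.
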